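(* Let $X$ be a random variable taking values in the $\sigma$-finite measure space $(\mathcal X,\mathscr X,\mu)$, with distribution $\mu_X\ll\mu$ and $|h_\mu(X)|<\infty$. Let $(\mathcal Y,\mathscr Y)$ be a measurable space and let $\rho\colon\mathcal X\times\mathcal Y\to[0,\infty]$ be a distortion function. Let $k\in(0,\infty)$ and suppose that $\mu$ is $\rho^{1/k}$-subregular of dimension $m\in(0,\infty)$ with subregularity constants $c\in(0,\infty)$ and $\delta_0\in(0,\infty]$. Finally, assume that $\mu(\mathcal X)=1$ if $\delta_0<\infty$. Then $$R_X^{\mathrm{SLB}}(D)\ge R_X^{\mathrm L}(D)\quad\text{for all }D\in(0,\infty),$$ where $R_X^{\mathrm L}(D)$ is defined as follows. (i) If $\delta_0=\infty$, then $$R_X^{\mathrm L}(D)=h_\mu(X)+F_{m,k,c}(D).$$ (ii) If $\delta_0<\infty$, then $$R_X^{\mathrm L}(D)=h_\mu(X)-\frac mk-\log\left(c\left(\frac{m}{kD}\right)^{-\frac mk}\Gamma\left(1+\frac mk\right)+e^{-\frac{m\delta_0^k}{kD}}\right),$$ and in this case $$R_X^{\mathrm L}(D)<h_\mu(X)+F_{m,k,c}(D)\quad\text{for all }D\in(0,\infty)$$ and $$\lim_{D\to0}\left(R_X^{\mathrm L}(D)-h_\mu(X)-F_{m,k,c}(D)\right)=0.$$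
   Context: All measures are positive, and $\sigma$-algebras contain all singletons. A distortion function $\rho\colon\mathcal X\times\mathcal Y\to[0,\infty]$ is a function measurable with respect to the product $\sigma$-algebra. $\log$ is the natural logarithm, and $0\cdot\infty=0$. For a distortion function $\varrho$ on $\mathcal X\times\mathcal Y$, a measure $\mu$ on $(\mathcal X,\mathscr X)$ is $\varrho$-subregular of dimension $m\in[0,\infty)$ with subregularity constants $c\in(0,\infty)$ and $\delta_0\in(0,\infty]$ if $$\mu(\{x\in\mathcal X:\varrho(x,y)<\delta\})\le c\,\delta^m\quad\text{for all }y\in\mathcal Y\text{ and }\delta\in(0,\delta_0).$$ Generalized entropy: for $\mu_X\ll\mu$ with $\mu$ $\sigma$-finite, $h_\mu(X)=-\mathbb E\left[\log\left(\frac{\mathrm d\mu_X}{\mathrm d\mu}(X)\right)\right]$. For $D\in(0,\infty)$, $$R_X^{\mathrm{SLB}}(D)=h_\mu(X)-\inf_{s\ge0}\left(sD+\log(g(s))\right),\qquad g(s)=\sup_{y\in\mathcal Y}\int e^{-s\rho(x,y)}\,\mathrm d\mu(x),$$ with $\log 0=-\infty$ and $\log\infty=\infty$. For $m,k,c,D\in(0,\infty)$, $$F_{m,k,c}(D)=\log\left(\frac{\left(\frac{m}{kD}\right)^{\frac mk}}{c\,\Gamma\left(1+\frac mk\right)}\right)-\frac mk.$$ *)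

(* Defs.v *)
From HB Require Import structures.
From mathcomp Require Import all_boot all_order all_algebra.
From mathcomp Require Import all_classical all_reals all_analysis.
From mathcomp Require Import measurable_realfun.

Set Implicit Arguments.
Unset Strict Implicit.
Unset Printing Implicit Defensive.

Import Order.TTheory GRing.Theory Num.Theory.
Import numFieldNormedType.Exports.

Local Open Scope classical_set_scope.
Local Open Scope ring_scope.
Local Open Scope charge_scope.

Definition Gamma (R : realType) (a : R) : R :=
  \int[@lebesgue_measure R]_(t in `]0, +oo[) (t `^ (a - 1) * expR (- t)).

Definition distortion (R : realType) (dX dY : measure_display)
    (X : measurableType dX) (Y : measurableType dY) (rho : X -> Y -> \bar R) :=
  (forall x y, (0 <= rho x y)%E) /\
  measurable_fun [set: X * Y] (fun p => rho p.1 p.2).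

Definition subregular (R : realType) (dX dY : measure_display)
    (X : measurableType dX) (Y : measurableType dY)
    (mu : {measure set X -> \bar R}) (rho : X -> Y -> \bar R)
    (m c : R) (delta0 : \bar R) :=
  forall (y : Y) (delta : R), 0 < delta -> (delta%:E < delta0)%E ->
    (mu [set x | (rho x y < delta%:E)%E] <= (c * delta `^ m)%:E)%E.

Section entropy.
Local Open Scope ereal_scope.

(* The integral of a function whose positive and negative parts both have
   infinite integral is -oo, so a finite entropy means that the logarithm of the
   density is P-integrable. *)
Definition entropy (R : realType) (dO dX : measure_display)
    (Omega : measurableType dO) (T : measurableType dX)
    (P : probability Omega R) (mu : {sigma_finite_measure set T -> \bar R})
    (X : {RV P >-> T}) : \bar R :=
  - \int[P]_w lne
      (('d (charge_of_finite_measure (distribution P X)) '/d mu) (X w)).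

(* The library conventions are the intended ones: lne 0 = -oo, lne +oo = +oo,
   expeR -oo = 0, and 0 * +oo = 0 in \bar R. If Y is empty, the supremum is
   -oo instead of 0, but its logarithm is -oo in both cases. *)
Definition gSLB (R : realType) (dX dY : measure_display)
    (T : measurableType dX) (Y : measurableType dY)
    (mu : {measure set T -> \bar R}) (rho : T -> Y -> \bar R) (s : R) : \bar R :=
  ereal_sup (range (fun y : Y => \int[mu]_x expeR (- (s%:E * rho x y)))).

Definition RSLB (R : realType) (dO dX dY : measure_display)
    (Omega : measurableType dO) (T : measurableType dX) (Y : measurableType dY)
    (P : probability Omega R) (mu : {sigma_finite_measure set T -> \bar R})
    (X : {RV P >-> T}) (rho : T -> Y -> \bar R) (D : R) : \bar R :=
  entropy mu X -
  ereal_inf [set (s * D)%:E + lne (gSLB mu rho s) | s in [set s : R | (0 <= s)%R]].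

End entropy.

Definition Fmkc (R : realType) (m k c D : R) : R :=
  ln ((m / (k * D)) `^ (m / k) / (c * Gamma (1 + m / k))) - m / k.

Definition RL (R : realType) (dO dX : measure_display)
    (Omega : measurableType dO) (T : measurableType dX)
    (P : probability Omega R) (mu : {sigma_finite_measure set T -> \bar R})
    (X : {RV P >-> T}) (m k c : R) (delta0 : \bar R) (D : R) : \bar R :=
  if delta0 == +oo%E then (entropy mu X + (Fmkc m k c D)%:E)%E
  else (entropy mu X - (m / k)%:E -
        (ln (c * (m / (k * D)) `^ (- (m / k)) * Gamma (1 + m / k) +
             expR (- (m * fine delta0 `^ k / (k * D)))))%:E)%E.

(* Main.v *)
Require Import Defs.
From HB Require Import structures.
From mathcomp Require Import all_boot all_order all_algebra.
From mathcomp Require Import all_classical all_reals all_analysis.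
From mathcomp Require Import measurable_realfun.
From mathcomp Require Import ring lra.

(** The Shannon lower bound involves the infimum over [s] of
    [s D + log g(s)], so any single value of [s] bounds the former from below. The
    choice [s = m / (k D)] minimizes [s D - (m / k) log s], and makes
    [s D = m / k]. Everything then rests on the estimate ([gSLB_le])
    [g(s) <= c s^(-m/k) Gamma(1 + m/k) + exp(- s delta0^k)], in which the last
    term vanishes when [delta0] is infinite.

    The estimate comes from the layer-cake formula
    ([integral_expeRN_layer_cake])
    [int e^(-f) dmu = int e^(-u) mu(f < u) du], which is Tonelli's theorem
    applied to [e^(-v) = int_(u > v) e^(-u) du]. For [f = s rho(., y)],
    subregularity gives [mu(f < u) <= c (u / s)^(m/k)] as long as
    [u < s delta0^k]; these [u] contribute at most the Gamma integral. For the
    other [u] the total mass 1 is used, and they contribute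
    [exp(- s delta0^k)]. Working with [s rho] and not with [rho] puts the
    scaling into the constant, so that no change of variables is needed.

    When [delta0] is finite, put [A = c s^(-m/k) Gamma(1 + m/k)] and
    [E = exp(- s delta0^k)]. The two bounds then differ by
    [- ln (1 + E / A)], which is negative; and since [s] is of order [1 / D]
    and exponentials dominate powers, [0 <= ln (1 + E / A) <= E / A = O(D)],
    whence the limit at 0. *)

Import Order.TTheory GRing.Theory Num.Theory.
Import numFieldNormedType.Exports.

Local Open Scope classical_set_scope.
Local Open Scope ring_scope.

(** * Powers against exponentials *)

(** The bound [x <= exp x] at [x = t / (2 a)], raised to the power [a]. Keeping
    half of the exponent leaves a factor [exp (- t / 2)] when the result is
    multiplied by [exp (- t)]: this is what makes the Gamma integral converge
    and the correction term decay. *)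
Lemma powR_le_expR {R : realType} (a t : R) : 0 < a -> 0 <= t ->
  t `^ a <= (2 * a) `^ a * expR (t / 2).
Proof.
move=> a0 t0; have a20 : 0 < 2 * a by rewrite mulr_gt0.
have -> : expR (t / 2) = expR (t / (2 * a)) `^ a.
  by rewrite -expRM; congr expR; field; rewrite gt_eqF.
rewrite -powRM ?expR_ge0 ?(ltW a20)//.
have ta : t <= 2 * a * expR (t / (2 * a)).
  rewrite -ler_pdivrMl// mulrC; apply: le_trans (expR_ge1Dx _).
  by rewrite lerDr.
by apply: ge0_ler_powR; rewrite ?nnegrE ?(ltW a0) ?(le_trans t0 ta).
Qed.

Lemma powR_expRN_le {R : realType} (a t : R) : 0 < a -> 0 < t ->
  t `^ a * expR (- t) <= (2 * a) `^ a * 2 / t.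
Proof.
move=> a0 t0.
have -> : expR (- t) = (expR (t / 2))^-1 * (expR (t / 2))^-1.
  by rewrite -expRN -expRD; congr expR; lra.
rewrite mulrA; apply: (@le_trans _ _ ((2 * a) `^ a * (expR (t / 2))^-1)).
  rewrite ler_wpM2r ?invr_ge0 ?expR_ge0// ler_pdivrMr ?expR_gt0//.
  by rewrite powR_le_expR// ltW.
rewrite -mulrA ler_wpM2l ?powR_ge0// -[leRHS]invf_div.
rewrite lef_pV2 ?posrE ?expR_gt0 ?divr_gt0//.
by apply: le_trans (expR_ge1Dx _); rewrite lerDr.
Qed.

(** * Tails of the exponential density *)

Section exponential_integrals.
Context {R : realType}.
Local Notation leb := (@lebesgue_measure R).
Local Open Scope ereal_scope.

Lemma measurable_expRN (D : set R) :
  measurable_fun D (fun u : R => (expR (- u))%:E).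
Proof.
apply/measurable_funTS/measurable_EFinP/measurableT_comp => //.
Qed.

Lemma integral_expRN_itvcy (r : R) :
  \int[leb]_(u in `[r, +oo[) (expR (- u))%:E = (expR (- r))%:E.
Proof.
have cexp : continuous (fun u : R => expR (- u)).
  move=> z; apply: continuous_comp; last exact: continuous_expR.
  exact: opp_continuous.
rewrite (@ge0_continuous_FTC2y _ _ (fun u => - expR (- u))%R _ 0)//.
- by rewrite EFinN oppeK add0e.
- exact: continuous_subspaceT.
- by rewrite -oppr0; apply: cvgN; exact: cvgr_expR.
- by apply: cvgN; apply/cvg_at_right_filter; exact: cexp.
- move=> z _; rewrite derive1E derive_val.
  by rewrite /GRing.scale/= mulrN1 opprK.
Qed.

(** Allowing an infinite threshold, where both sides vanish, treats finite and
    infinite distortion, and finite and infinite [delta0], uniformly. *)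
Lemma integral_expRN_ge (v : \bar R) : 0 <= v ->
  \int[leb]_(u in [set u | v <= u%:E]) (expR (- u))%:E = expeR (- v).
Proof.
case: v => [r _|_|//] /=.
  rewrite -integral_expRN_itvcy; congr integral.
  by apply/seteqP; split => u /=; rewrite in_itv/= andbT lee_fin.
rewrite -[RHS](@integral_set0 _ _ _ leb (fun u : R => (expR (- u))%:E)).
by congr integral; apply/seteqP; split => u //=; rewrite leye_eq.
Qed.

Lemma integral_expRN_gt (v : \bar R) : 0 <= v ->
  \int[leb]_(u in [set u | v < u%:E]) (expR (- u))%:E = expeR (- v).
Proof.
case: v => [r _|_|//] /=.
  rewrite -integral_expRN_itvcy -integral_itv_obnd_cbnd; last first.
    exact: measurable_expRN.
  by congr integral; apply/seteqP; split => u /=; rewrite in_itv/= andbT lte_fin.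
rewrite -[RHS](@integral_set0 _ _ _ leb (fun u : R => (expR (- u))%:E)).
by congr integral; apply/seteqP; split => u //=; rewrite ltNge leey.
Qed.

End exponential_integrals.

(** * The Gamma integral *)

Section gamma.
Context {R : realType}.
Local Notation leb := (@lebesgue_measure R).
Local Open Scope ereal_scope.

Lemma measurable_gamma_integrand (D : set R) (a : R) :
  measurable_fun D (fun t : R => (t `^ a * expR (- t))%:E).
Proof.
apply/measurable_funTS/measurable_EFinP/measurable_funM.
  exact: measurable_powR.
exact: measurableT_comp.
Qed.

(** The integrand is at most a constant times the density of the exponential
    distribution with rate [1 / 2]. *)
Lemma gamma_integral_lty (a : R) : (0 < a)%R ->
  \int[leb]_(t in `]0%R, +oo[) (t `^ a * expR (- t))%:E < +oo.
Proof.
move=> a0; pose C := ((2 * a) `^ a * 2)%R.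
have C0 : (0 <= C)%R by rewrite mulr_ge0 ?powR_ge0.
apply: (@le_lt_trans _ _
    (\int[leb]_(t in `]0%R, +oo[) (C%:E * (exponential_pdf 2^-1 t)%:E))).
  apply: ge0_le_integral => //=.
  - by move=> t _; rewrite lee_fin mulr_ge0 ?powR_ge0 ?expR_ge0.
  - exact: measurable_gamma_integrand.
  - apply: measurable_funTS; apply/measurable_EFinP/measurable_funM => //.
    exact: measurable_exponential_pdf.
  - move=> t; rewrite /= in_itv/= andbT => /ltW t0; rewrite lee_fin.
    rewrite exponential_pdfE// /C -mulrA (mulrA 2%R) divff ?mul1r//.
    have -> : (expR (- 2^-1 * t) = expR (t / 2) * expR (- t))%R.
      by rewrite -expRD; congr expR; lra.
    by rewrite mulrA ler_wpM2r ?expR_ge0// powR_le_expR.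
rewrite ge0_integralZl//=; last 2 first.
- apply: measurable_funTS; apply/measurable_EFinP.
  exact: measurable_exponential_pdf.
- by move=> t _; rewrite lee_fin exponential_pdf_ge0.
apply: (@le_lt_trans _ _ (C%:E * 1)); last by rewrite mule1 ltry.
rewrite lee_wpmul2l// -(@integral_exponential_pdf R 2^-1)//.
apply: ge0_subset_integral => //=.
- by apply/measurable_EFinP; exact: measurable_exponential_pdf.
- by move=> t _; rewrite lee_fin exponential_pdf_ge0.
Qed.

(** [Gamma] is the real part of an extended integral, hence would be 0 if that
    integral were infinite; the finiteness just shown rules this out. *)
Lemma GammaE (a : R) : (0 < a)%R ->
  \int[leb]_(t in `]0%R, +oo[) (t `^ a * expR (- t))%:E = (Gamma (1 + a))%:E.
Proof.
move=> a0; rewrite /Gamma /Rintegral addrAC subrr add0r fineK//.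
rewrite ge0_fin_numE ?gamma_integral_lty//.
by apply: integral_ge0 => t _; rewrite lee_fin mulr_ge0 ?powR_ge0 ?expR_ge0.
Qed.

(** On [1, +oo[ the integrand dominates [exp (- t)], so [Gamma (1 + a)] is at
    least [exp (- 1)]. *)
Lemma Gamma_gt0 (a : R) : (0 < a)%R -> (0 < Gamma (1 + a))%R.
Proof.
move=> a0; rewrite -lte_fin -GammaE//.
apply: (@lt_le_trans _ _ (expR (- 1))%:E); first by rewrite lte_fin expR_gt0.
rewrite -integral_expRN_itvcy.
have g0 (t : R) : 0 <= (t `^ a * expR (- t))%:E.
  by rewrite lee_fin mulr_ge0 ?powR_ge0 ?expR_ge0.
apply: (@le_trans _ _ (\int[leb]_(t in `[1%R, +oo[) (t `^ a * expR (- t))%:E)).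
  apply: ge0_le_integral => //=.
  - exact: measurable_expRN.
  - exact: measurable_gamma_integrand.
  - move=> t; rewrite /= in_itv/= andbT => t1; rewrite lee_fin.
    rewrite ler_peMl ?expR_ge0//.
    by rewrite -(powRr0 t) ler_powR// ltW.
apply: ge0_subset_integral => //=; first exact: measurable_gamma_integrand.
by move=> t /=; rewrite !in_itv/= !andbT; exact: lt_le_trans.
Qed.

End gamma.

(** * The layer-cake formula for Laplace transforms *)

Section laplace.
Context {R : realType} {d} {T : measurableType d}.
Variable mu : {sigma_finite_measure set T -> \bar R}.
Local Notation leb := (@lebesgue_measure R).
Local Open Scope ereal_scope.

Lemma measurable_strict_epigraph (f : T -> \bar R) : measurable_fun setT f ->
  measurable [set p : T * R | f p.1 < p.2%:E].
Proof.
move=> mf; rewrite -[X in measurable X]setTI; apply: measurable_lte => //.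
  exact: measurableT_comp.
by apply/measurable_EFinP; exact: measurable_snd.
Qed.

Lemma measurable_sublevel_measure (f : T -> \bar R) : measurable_fun setT f ->
  measurable_fun setT (fun u : R => mu [set x | f x < u%:E]).
Proof.
move=> mf; have := measurable_fun_ysection mu (measurable_strict_epigraph f mf).
apply: eq_measurable_fun => u _ /=; congr (mu _).
by apply/seteqP; split => x; rewrite /ysection/= inE.
Qed.

(** Write [expeR (- f x)] as the integral of [exp (- u)] over [u > f x], and
    exchange the two integrals. *)
Lemma integral_expeRN_layer_cake (f : T -> \bar R) :
  measurable_fun setT f -> (forall x, 0 <= f x) ->
  \int[mu]_x expeR (- f x) =
  \int[leb]_u ((expR (- u))%:E * mu [set x | f x < u%:E]).
Proof.
move=> mf f0.
pose E := [set p : T * R | f p.1 < p.2%:E].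
pose h := (fun p : T * R => (expR (- p.2))%:E) \_ E.
have mE : measurable E by exact: measurable_strict_epigraph.
have mh : measurable_fun setT h.
  apply/(measurable_restrictT _ mE)/measurable_funTS.
  by apply: (measurableT_comp (measurable_expRN setT)); exact: measurable_snd.
have h0 p : 0 <= h p by apply: erestrict_ge0 => q _; rewrite lee_fin expR_ge0.
transitivity (\int[mu]_x \int[leb]_u h (x, u)).
  apply: eq_integral => x _; rewrite -integral_expRN_gt// integral_mkcond.
  by apply: eq_integral => u _; rewrite /h !patchE; congr (if _ then _ else _);
    apply/idP/idP; rewrite !inE.
rewrite fubini_tonelli//; apply: eq_integral => u _.
rewrite -integral_cst; last first.
  by rewrite -[X in measurable X]setTI; exact: emeasurable_fun_infty_o.
rewrite [RHS]integral_mkcond.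
by apply: eq_integral => x _; rewrite /h !patchE; congr (if _ then _ else _);
  apply/idP/idP; rewrite !inE.
Qed.

(** In the layer-cake formula, the levels below [v] are controlled by the
    growth bound on [mu (f < u)] and those above [v] by the total mass. *)
Lemma integral_expeRN_le (f : T -> \bar R) (a b : R) (v : \bar R) :
  measurable_fun setT f -> (forall x, 0 <= f x) ->
  (0 < a)%R -> (0 <= b)%R -> 0 <= v ->
  (forall u : R, (0 < u)%R -> u%:E < v ->
    mu [set x | f x < u%:E] <= (b * u `^ a)%:E) ->
  (v < +oo -> mu setT <= 1) ->
  \int[mu]_x expeR (- f x) <= (b * Gamma (1 + a))%:E + expeR (- v).
Proof.
move=> mf f0 a0 b0 v0 small total.
have mv : measurable [set u : R | v <= u%:E].
  by rewrite -[X in measurable X]setTI; exact: measurable_lee.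
have mfu u : measurable [set x | f x < u%:E].
  by rewrite -[X in measurable X]setTI; exact: emeasurable_fun_infty_o.
pose A := (fun u : R => b%:E * (u `^ a * expR (- u))%:E) \_ `]0%R, +oo[.
pose B := (fun u : R => (expR (- u))%:E) \_ [set u | v <= u%:E].
have A0 u : 0 <= A u.
  apply: erestrict_ge0 => t _.
  by rewrite mule_ge0// lee_fin ?mulr_ge0 ?powR_ge0 ?expR_ge0.
have B0 u : 0 <= B u by apply: erestrict_ge0 => t _; rewrite lee_fin expR_ge0.
have mA : measurable_fun setT A.
  apply/(measurable_restrictT _ (measurable_itv _)).
  by apply: measurable_funeM; exact: measurable_gamma_integrand.
have mB : measurable_fun setT B.
  by apply/(measurable_restrictT _ mv); exact: measurable_expRN.
rewrite integral_expeRN_layer_cake//.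
(* [A] alone bounds the integrand for [0 < u < v], and [B] alone for
   [u >= v]; for [u <= 0] the sublevel set is empty. *)
apply: (@le_trans _ _ (\int[leb]_u (A u + B u))).
  apply: ge0_le_integral => //=.
  - by move=> u _; rewrite mule_ge0// lee_fin expR_ge0.
  - apply: emeasurable_funM; last exact: measurable_sublevel_measure.
    exact: measurable_expRN.
  - exact: emeasurable_funD.
  - move=> u _; have [u0|u0] := leP u 0%R.
      rewrite (_ : [set x | f x < u%:E] = set0) ?measure0 ?mule0 ?adde_ge0//.
      apply/seteqP; split => x //=; rewrite ltNge (le_trans _ (f0 x))//.
    have [vu|uv] := leP v u%:E.
      rewrite -[leLHS]add0e leeD// /B patchE mem_set//.
      rewrite -[leRHS]mule1 lee_wpmul2l ?lee_fin ?expR_ge0//.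
      rewrite (@le_trans _ _ (mu setT))//.
        by apply: le_measure; rewrite ?inE.
      by apply: total; exact: le_lt_trans vu (ltry _).
    rewrite -[leLHS]adde0 leeD// /A patchE mem_set/=; last first.
      by rewrite in_itv/= u0.
    rewrite mulrC EFinM muleCA lee_wpmul2l ?lee_fin ?expR_ge0//.
    by rewrite -EFinM small.
rewrite ge0_integralD// -!integral_mkcond leeD//.
  rewrite ge0_integralZl ?GammaE//.
  - exact: measurable_gamma_integrand.
  - by move=> t _; rewrite lee_fin mulr_ge0 ?powR_ge0 ?expR_ge0.
by rewrite integral_expRN_ge.
Qed.
End laplace.

(** * The bound on the Shannon lower bound *)

Lemma lte_poweR {R : realType} (r : R) (x y : \bar R) :
  0 < r -> (0 <= x)%E -> (0 <= y)%E -> (x `^ r < y `^ r)%E = (x < y)%E.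
Proof.
move=> r0 x0 y0; rewrite !ltNge; congr (~~ _).
have homo (p : R) (z w : \bar R) : 0 < p -> (0 <= z)%E -> (z <= w)%E ->
    (z `^ p <= w `^ p)%E.
  move=> p0 z0 zw; apply: gt0_ler_poweR => //; first exact: ltW.
    by rewrite in_itv/= z0 leey.
  by rewrite in_itv/= (le_trans z0 zw) leey.
have powK (z : \bar R) : (0 <= z)%E -> ((z `^ r) `^ r^-1 = z)%E.
  by move=> z0; rewrite -poweRrM divff ?gt_eqF// poweRe1.
apply/idP/idP => [yx|]; last exact: homo.
rewrite -(powK x)// -(powK y)//; apply: homo; rewrite ?invr_gt0//.
exact: poweR_ge0.
Qed.

(** The sublevel set of [s rho(., y)] at level [u] is that of [rho^(1/k)] at
    level [(u / s)^(1/k)], and the latter is below [delta0] exactly when [u] is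
    below [s delta0^k]. *)
Lemma gSLB_le {R : realType} {dX dY : measure_display}
    {T : measurableType dX} {Y : measurableType dY}
    (mu : {sigma_finite_measure set T -> \bar R}) (rho : T -> Y -> \bar R)
    (m k c s : R) (delta0 : \bar R) :
  distortion rho -> 0 < k -> 0 < m -> 0 < c -> 0 < s -> (0 < delta0)%E ->
  subregular mu (fun x y => (rho x y `^ k^-1)%E) m c delta0 ->
  ((delta0 < +oo)%E -> mu [set: T] = 1%E) ->
  (gSLB mu rho s <= (c * s `^ (- (m / k)) * Gamma (1 + m / k))%:E
                    + expeR (- (s%:E * delta0 `^ k)))%E.
Proof.
move=> [rho0 mrho] k0 m0 c0 s0 d0 sub prob.
have ki0 : 0 < k^-1 by rewrite invr_gt0.
have se0 : (0 <= s%:E)%E by rewrite lee_fin ltW.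
apply: ge_ereal_sup => _ [y _ <-].
have mf : measurable_fun [set: T] (fun x => (s%:E * rho x y)%E).
  apply: measurable_funeM.
  exact: (measurableT_comp mrho (pair2_measurable y)).
have dk0 : (0 <= delta0 `^ k)%E by exact: poweR_ge0.
apply: integral_expeRN_le => //.
- by move=> x; rewrite mule_ge0.
- exact: divr_gt0.
- by rewrite mulr_ge0 ?powR_ge0 ?ltW.
- by rewrite mule_ge0.
- move=> u u0 usd.
  have us0 : 0 < u / s by exact: divr_gt0.
  pose delta := (u / s) `^ k^-1.
  have delta_lt : (delta%:E < delta0)%E.
    rewrite -(@lte_poweR _ k)//; [|by rewrite lee_fin powR_ge0|exact: ltW].
    rewrite poweR_EFin -powRrM mulVf ?gt_eqF// powRr1 ?ltW//.
    by rewrite mulrC EFinM lte_pdivrMl.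
  have sublevelE : [set x | (s%:E * rho x y < u%:E)%E] =
                   [set x | (rho x y `^ k^-1 < delta%:E)%E].
    apply/seteqP; split => x /=; rewrite -poweR_EFin;
      by rewrite lte_poweR ?lee_fin ?(ltW us0)// mulrC EFinM lte_pdivlMl.
  have -> : c * s `^ (- (m / k)) * u `^ (m / k) = c * delta `^ m.
    have sV : s^-1 `^ (m / k) = s `^ (- (m / k)).
      by rewrite -powR_inv1 ?ltW// -powRrM mulN1r.
    rewrite /delta -powRrM (mulrC k^-1).
    rewrite powRM ?(ltW u0) ?invr_ge0 ?(ltW s0)// sV.
    by rewrite -mulrA [in RHS](mulrC (u `^ _)).
  by rewrite sublevelE; apply: sub => //; exact: powR_gt0.
- move=> sd; rewrite prob// ltNge leye_eq; apply/eqP => dy.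
  by move: sd; rewrite dy poweRyr ?gt_eqF// gt0_muley ?lte_fin// ltxx.
Qed.

Lemma FmkcE {R : realType} (m k c D : R) : 0 < m -> 0 < k -> 0 < c -> 0 < D ->
  Fmkc m k c D =
  - (m / k) - ln (c * (m / (k * D)) `^ (- (m / k)) * Gamma (1 + m / k)).
Proof.
move=> m0 k0 c0 D0; rewrite /Fmkc.
have a0 : 0 < m / k by exact: divr_gt0.
have s0 : 0 < m / (k * D) by rewrite divr_gt0 ?mulr_gt0.
have G0 := Gamma_gt0 _ a0.
rewrite addrC; congr (_ + _).
rewrite -lnV ?posrE ?mulr_gt0 ?powR_gt0//; congr (ln _).
by rewrite powRN !invfM invrK mulrCA mulrA mulrC mulrA.
Qed.

(** The infimum is at most its value at [s]. If [g(s) <= 0], in particular if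
    [Y] is empty, then [lne (g(s))] is [-oo] and the bound still holds. *)
Lemma RSLB_ge {R : realType} {dO dX dY : measure_display}
    {Omega : measurableType dO} {T : measurableType dX} {Y : measurableType dY}
    {P : probability Omega R} (mu : {sigma_finite_measure set T -> \bar R})
    (X : {RV P >-> T}) (rho : T -> Y -> \bar R) (s D b : R) :
  0 <= s -> 0 < b -> (gSLB mu rho s <= b%:E)%E ->
  (entropy mu X - (s * D + ln b)%:E <= RSLB mu X rho D)%E.
Proof.
move=> s0 b0 gb; apply: leeB => //.
apply: (@le_trans _ _ ((s * D)%:E + lne (gSLB mu rho s))%E).
  by apply: ereal_inf_lbound; exists s.
rewrite EFinD leeD2l// -lne_EFin//.
have [g0|g0] := leP (gSLB mu rho s) 0%E; first by rewrite le0_lneNy// leNye.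
by rewrite lee_lne// in_itv/= leey andbT ?lee_fin ltW.
Qed.

(** One formula for both cases of the definition of [RL]: for infinite [delta0]
    the exponential term is 0. *)
Lemma RLE {R : realType} {dO dX : measure_display}
    {Omega : measurableType dO} {T : measurableType dX}
    {P : probability Omega R} (mu : {sigma_finite_measure set T -> \bar R})
    (X : {RV P >-> T}) (m k c D : R) (delta0 : \bar R) :
  0 < m -> 0 < k -> 0 < c -> 0 < D -> (0 < delta0)%E ->
  RL mu X m k c delta0 D =
  (entropy mu X -
   (m / k + ln (c * (m / (k * D)) `^ (- (m / k)) * Gamma (1 + m / k) +
                fine (expeR (- ((m / (k * D))%:E * delta0 `^ k)))))%:E)%E.
Proof.
move=> m0 k0 c0 D0 d0; have s0 : 0 < m / (k * D) by rewrite divr_gt0 ?mulr_gt0.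
rewrite /RL; case: delta0 d0 => [r _|_|//].
  rewrite /= opprD EFinD addeA; congr (_ + (- ln (_ + expR (- _)))%:E)%E.
  by rewrite mulrAC.
by rewrite eqxx poweRyr ?gt_eqF// gt0_muley ?lte_fin//= FmkcE// addr0 opprD.
Qed.

(** * The limit at zero *)

(** With [s = m / (k D)] the right-hand side is linear in [D]. *)
Lemma tail_ratio_le {R : realType} (a c s q : R) :
  0 < a -> 0 < c -> 0 < s -> 0 < q ->
  expR (- (s * q)) / (c * s `^ (- a) * Gamma (1 + a)) <=
  (2 * a) `^ a * 2 / (q * q `^ a * c * Gamma (1 + a)) * s^-1.
Proof.
move=> a0 c0 s0 q0; have G0 := Gamma_gt0 _ a0.
have qa0 : 0 < q `^ a by exact: powR_gt0.
have sa0 : 0 < s `^ a by exact: powR_gt0.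
have := powR_expRN_le _ _ a0 (mulr_gt0 s0 q0).
rewrite (powRM _ (ltW s0) (ltW q0)) => h.
have -> : expR (- (s * q)) / (c * s `^ (- a) * Gamma (1 + a)) =
    (s `^ a * q `^ a * expR (- (s * q))) / (q `^ a * c * Gamma (1 + a)).
  by rewrite powRN; field; rewrite !gt_eqF.
rewrite ler_pdivrMr ?mulr_gt0//; apply: (le_trans h).
set K := (2 * a) `^ a * 2.
rewrite [leRHS](_ : _ = K / (s * q)) ?lexx//.
by field; rewrite !gt_eqF.
Qed.

Lemma cvg_at_right0_squeeze {R : realType} (f : R -> \bar R) (g : R -> R)
    (C : R) :
  (forall t, 0 < t -> f t = (- g t)%:E) ->
  (forall t, 0 < t -> 0 <= g t <= C * t) ->
  f t @[t --> 0^'+] --> 0%E.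
Proof.
move=> fg g_le.
have near0 (S : R -> Prop) :
    (forall t, 0 < t -> S t) -> \forall t \near 0^'+, S t.
  by move=> St; near=> t; apply: St; near: t; exact: nbhs_right_gt.
have fgE : \forall t \near 0^'+, (- g t)%:E = f t.
  by apply: near0 => t t0; rewrite fg.
apply: cvg_trans (near_eq_cvg fgE) _.
apply: cvg_EFin; first exact: near0.
rewrite -[X in _ --> X]oppr0; apply: cvgN.
have g_near : \forall t \near 0^'+, cst 0 t <= g t <= C * t by exact: near0.
apply: (squeeze_cvgr g_near); first exact: cvg_cst.
rewrite -[X in _ --> X](mulr0 C); apply: cvgMl_tmp.
exact: cvg_at_right_filter.
Unshelve. all: by end_near.
Qed.

Theorem theorem3p1 (R : realType) (dO dX dY : measure_display)
    (Omega : measurableType dO) (T : measurableType dX) (Y : measurableType dY)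
    (P : probability Omega R) (mu : {sigma_finite_measure set T -> \bar R})
    (X : {RV P >-> T}) (rho : T -> Y -> \bar R)
    (m k c : R) (delta0 : \bar R)
    (singletons_T : forall x : T, measurable [set x])
    (singletons_Y : forall y : Y, measurable [set y])
    (X_mu : distribution P X `<< mu)
    (finite_entropy : (`|entropy mu X| < +oo)%E)
    (distortion_rho : distortion rho)
    (k_gt0 : 0 < k) (m_gt0 : 0 < m) (c_gt0 : 0 < c) (delta0_gt0 : (0 < delta0)%E)
    (subregular_mu :
      subregular mu (fun x y => (rho x y `^ k^-1)%E) m c delta0)
    (mu_prob : (delta0 < +oo)%E -> mu [set: T] = 1%E) :
  (forall D : R, 0 < D ->
     (RL mu X m k c delta0 D <= RSLB mu X rho D)%E) /\
  ((delta0 < +oo)%E ->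
     (forall D : R, 0 < D ->
        (RL mu X m k c delta0 D < entropy mu X + (Fmkc m k c D)%:E)%E) /\
     (RL mu X m k c delta0 D - entropy mu X - (Fmkc m k c D)%:E)%E
        @[D --> 0^'+] --> 0%E).
Proof.
have a0 : 0 < m / k by exact: divr_gt0.
have G0 := Gamma_gt0 _ a0.
have s0 (D : R) : 0 < D -> 0 < m / (k * D).
  by move=> D0; rewrite divr_gt0 ?mulr_gt0.
pose A (D : R) := c * (m / (k * D)) `^ (- (m / k)) * Gamma (1 + m / k).
have A0 (D : R) : 0 < D -> 0 < A D.
  by move=> /s0 sD; rewrite !mulr_gt0 ?powR_gt0.
split=> [D D0|].
  have v0 : (0 <= (m / (k * D))%:E * delta0 `^ k)%E.
    by rewrite mule_ge0 ?poweR_ge0// lee_fin ltW ?s0.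
  have expfin : expeR (- ((m / (k * D))%:E * delta0 `^ k)) \is a fin_num.
    by case: (_ * _)%E v0.
  rewrite RLE//.
  have sDE : m / (k * D) * D = m / k by field; rewrite !gt_eqF.
  rewrite -[X in (X + ln _)]sDE.
  apply: RSLB_ge; first exact/ltW/s0.
    by rewrite ltr_wpDr ?A0// fine_ge0 ?expeR_ge0.
  by rewrite EFinD fineK//; apply: gSLB_le => //; exact: s0.
case: delta0 delta0_gt0 {subregular_mu mu_prob} => [r|//|//].
rewrite lte_fin => r0 _.
have hfin : entropy mu X \is a fin_num by rewrite fin_num_abs.
pose E (D : R) := expR (- (m / (k * D) * r `^ k)).
have E0 (D : R) : 0 < E D by exact: expR_gt0.
have RLr (D : R) : 0 < D -> RL mu X m k c r%:E D =
    (fine (entropy mu X) - (m / k + ln (A D + E D)))%:E.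
  by move=> D0; rewrite RLE ?lte_fin// EFinB fineK.
have FA (D : R) : 0 < D -> Fmkc m k c D = - (m / k) - ln (A D).
  by move=> ?; exact: FmkcE.
split=> [D D0|].
  rewrite RLr// FA// -{2}(fineK hfin) -EFinD lte_fin ltrD2l opprD ltrD2l.
  rewrite ltrN2.
  by rewrite ltr_ln ?posrE ?addr_gt0 ?A0// ltrDl.
have diffE (D : R) : 0 < D ->
    (RL mu X m k c r%:E D - entropy mu X - (Fmkc m k c D)%:E)%E =
    (- ln (1 + E D / A D))%:E.
  move=> D0; rewrite RLr// FA// -{2}(fineK hfin) -!EFinB; congr EFin.
  have -> : A D + E D = A D * (1 + E D / A D).
    by rewrite mulrDr mulr1 mulrCA divff ?mulr1// gt_eqF ?A0.
  rewrite lnM ?posrE ?A0// ?addr_gt0 ?divr_gt0 ?A0//.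
  by ring.
pose C := (2 * (m / k)) `^ (m / k) * 2 /
  (r `^ k * (r `^ k) `^ (m / k) * c * Gamma (1 + m / k)) * (k / m).
have ratio (D : R) : 0 < D -> 0 <= ln (1 + E D / A D) <= C * D.
  move=> D0; have EA0 : 0 < E D / A D by rewrite divr_gt0 ?A0.
  rewrite ln_ge0 ?lerDl ?(ltW EA0)//=.
  apply: (@le_trans _ _ (E D / A D)).
    by apply: le_ln1Dx; rewrite (lt_trans _ EA0) ?ltrN10.
  have rk0 : 0 < r `^ k by exact: powR_gt0.
  apply: le_trans (tail_ratio_le _ _ _ _ a0 c_gt0 (s0 D D0) rk0) _.
  by rewrite /C invf_div -[leRHS]mulrA (mulrAC k).
exact: (cvg_at_right0_squeeze _ _ _ diffE ratio).
Qed.
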